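(* Let $\mathbf{K}$ and $\mathbf{C}$ be convex bodies in $\mathbb{E}^d$, $d\ge 2$, and let $m$ and $n$ be positive integers. Consider all ways of slicing $\mathbf{K}$ into $n$ pieces by $n-1$ successive hyperplane cuts (i.e., when each cut divides one piece), and for each of them take the greatest of the $m$th successive $\mathbf{C}$-inradii of the $n$ pieces. Then the minimum of this greatest $m$th successive $\mathbf{C}$-inradius, over all such slicings, is the $(mn)$th successive $\mathbf{C}$-inradius of $\mathbf{K}$, i.e., $$\min_{(\mathbf{K}_1,\dots,\mathbf{K}_n)}\ \max_{1\le i\le n} r_{\mathbf{C}}(\mathbf{K}_i,m)=r_{\mathbf{C}}(\mathbf{K},mn),$$ where $(\mathbf{K}_1,\dots,\mathbf{K}_n)$ ranges over all families of pieces obtained from $\mathbf{K}$ by $n-1$ successive hyperplane cuts. Moreover, an optimal partition (one attaining the minimum) is achieved by $n-1$ parallel hyperplane cuts equally spaced along the minimal $\mathbf{C}$-width of the $r_{\mathbf{C}}(\mathbf{K},mn)\mathbf{C}$-rounded body of $\mathbf{K}$.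
   Context: $\mathbb{E}^d$ is $d$-dimensional Euclidean space. A convex body is a compact convex set with non-empty interior. For a convex body $\mathbf{C}$ and a hyperplane $H$, $w(\mathbf{C},H)$ is the distance between the two supporting hyperplanes of $\mathbf{C}$ parallel to $H$. For convex bodies $\mathbf{C},\mathbf{K}$ the $\mathbf{C}$-width of $\mathbf{K}$ parallel to $H$ is $w_{\mathbf{C}}(\mathbf{K},H)=w(\mathbf{K},H)/w(\mathbf{C},H)$, and the minimal $\mathbf{C}$-width of $\mathbf{K}$ is $w_{\mathbf{C}}(\mathbf{K})=\min_H w_{\mathbf{C}}(\mathbf{K},H)$ over all hyperplanes $H$ of $\mathbb{E}^d$. The $\mathbf{C}$-inradius of $\mathbf{K}$ is the largest $r>0$ such that some translate of $r\mathbf{C}$ is contained in $\mathbf{K}$. For $0<\rho\le r$ (with $r$ the $\mathbf{C}$-inradius of $\mathbf{K}$), the $\rho\mathbf{C}$-rounded body $\mathbf{K}^{\rho\mathbf{C}}$ of $\mathbf{K}$ is the union of all translates of $\rho\mathbf{C}$ contained in $\mathbf{K}$. For an integer $m\ge1$, the $m$th successive $\mathbf{C}$-inradius of $\mathbf{K}$, denoted $r_{\mathbf{C}}(\mathbf{K},m)$, is the uniquely determined $\rho\in(0,r]$ with $w_{\mathbf{C}}(\mathbf{K}^{\rho\mathbf{C}})=m\rho$. Successive hyperplane cuts: one starts with the single piece $\mathbf{K}$; each cut chooses exactly one of the current pieces and divides only that piece by a hyperplane into two pieces, namely its intersections with the two closed half-spaces bounded by the hyperplane, both having non-empty interior. Thus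 $n-1$ successive cuts yield $n$ convex bodies. ''Equally spaced along the minimal $\mathbf{C}$-width'' of a convex body $\mathbf{L}$ means: choosing a hyperplane $H$ with $w_{\mathbf{C}}(\mathbf{L},H)=w_{\mathbf{C}}(\mathbf{L})$, the $n-1$ cutting hyperplanes are parallel to $H$ and divide the region between the two supporting hyperplanes of $\mathbf{L}$ parallel to $H$ into $n$ slabs of equal width. *)

(* Defs.v *)
From HB Require Import structures.
From mathcomp Require Import all_boot all_order all_algebra.
From mathcomp Require Import all_classical all_reals all_analysis.
Set Implicit Arguments.
Unset Strict Implicit.
Unset Printing Implicit Defensive.
Import Order.TTheory GRing.Theory Num.Theory.
Import numFieldNormedType.Exports.
Local Open Scope classical_set_scope.
Local Open Scope ring_scope.

(* The norm that the library puts on 'rV[R]_d is the max norm.  It induces the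
   Euclidean topology, so compact and interior below are the usual notions, but
   distances have to be taken with the Euclidean norm enorm. *)
Section Euclidean.
Context {R : realType} {d : nat}.
Implicit Types (x y u : 'rV[R]_d) (a : R) (A B : set 'rV[R]_d).

Definition dot u x : R := \sum_(i < d) u ord0 i * x ord0 i.

Definition enorm x : R := Num.sqrt (dot x x).

Definition edist_set A B : R :=
  inf [set r | exists x y, [/\ A x, B y & r = enorm (x - y)]].

(* Throughout, u is meant to be nonzero; a family of parallel hyperplanes is
   given by its normal vector u. *)
Definition hyperplane u a : set 'rV[R]_d := [set x | dot u x = a].
Definition halfspace_le u a : set 'rV[R]_d := [set x | dot u x <= a].
Definition halfspace_ge u a : set 'rV[R]_d := [set x | a <= dot u x].

End Euclidean.

Section ConvexBodies.
Context {R : realType} {d : nat}.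
Implicit Types (u : 'rV[R]_d) (rho : R) (C K L : set 'rV[R]_d).

Definition convex_body K : Prop := [/\ compact K, convex_set K & K° !=set0].

(* The supporting hyperplanes of K orthogonal to u are
   hyperplane u (supp_max K u) and hyperplane u (supp_min K u). *)
Definition supp_max K u : R := sup [set dot u x | x in K].
Definition supp_min K u : R := inf [set dot u x | x in K].

(* w(K, H), for the hyperplanes H orthogonal to u *)
Definition width K u : R :=
  edist_set (hyperplane u (supp_max K u)) (hyperplane u (supp_min K u)).

Definition rel_width C K u : R := width K u / width C u.

Definition min_rel_width C K : R := inf [set rel_width C K u | u in [set u | u != 0]].

Definition homothet rho C (x : 'rV[R]_d) : set 'rV[R]_d :=
  [set x + rho *: c | c in C].

Definition inradius C K : R :=
  sup [set r | 0 < r /\ exists x, homothet r C x `<=` K].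

Definition rounded_body C K rho : set 'rV[R]_d :=
  \bigcup_(x in [set x | homothet rho C x `<=` K]) homothet rho C x.

(* Definite description: for convex bodies C and K and m >= 1 there is exactly
   one such rho. *)
Definition succ_inradius C K (m : nat) : R :=
  xget 0 [set rho | 0 < rho <= inradius C K /\
                    min_rel_width C (rounded_body C K rho) = m%:R * rho].

End ConvexBodies.

Section Cuts.
Context {R : realType} {d : nat}.
Implicit Types (u : 'rV[R]_d) (C K L P : set 'rV[R]_d).

(* successive_cuts K k Ks: Ks lists the k.+1 pieces of K left by k successive
   hyperplane cuts; the two parts of a divided piece take its place in the list. *)
Inductive successive_cuts K : nat -> seq (set 'rV[R]_d) -> Prop :=
| successive_cuts0 : successive_cuts K 0 [:: K]
| successive_cutsS k (Ks1 : seq (set 'rV[R]_d)) P (Ks2 : seq (set 'rV[R]_d)) u (a : R) :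
    successive_cuts K k (Ks1 ++ P :: Ks2) ->
    u != 0 ->
    (P `&` halfspace_le u a)° !=set0 ->
    (P `&` halfspace_ge u a)° !=set0 ->
    successive_cuts K k.+1
      (Ks1 ++ [:: P `&` halfspace_le u a, P `&` halfspace_ge u a & Ks2]).

(* All succ_inradius C L m are positive, so the default value 0 is harmless. *)
Definition max_succ_inradius C (m : nat) (Ks : seq (set 'rV[R]_d)) : R :=
  \big[Num.max/0]_(L <- Ks) succ_inradius C L m.

(* The hyperplanes hyperplane u (cut_level L u n k), 0 <= k <= n, divide the
   region between the supporting hyperplanes of L orthogonal to u into n slabs
   of equal width; those with 0 < k < n are the cutting hyperplanes. *)
Definition cut_level L u (n k : nat) : R :=
  supp_min L u + k%:R / n%:R * (supp_max L u - supp_min L u).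

(* The pieces into which the n.-1 cutting hyperplanes divide K.  The first and
   last pieces are bounded by one hyperplane only, since K may extend beyond
   the region between the supporting hyperplanes of L. *)
Definition equal_slices K L u (n : nat) : seq (set 'rV[R]_d) :=
  mkseq (fun k => K `&`
    [set x | ((0 < k)%N -> halfspace_ge u (cut_level L u n k) x) /\
             ((k.+1 < n)%N -> halfspace_le u (cut_level L u n k.+1) x)]) n.

End Cuts.

(* Main.v *)
(* Let A(r) be the set of all x with x + rC contained in K, so that K^(rC) is
   A(r) + rC and its minimal C-width is r plus that of A(r).  Hence the m-th
   successive C-inradius of K is the r for which A(r) has minimal C-width (m-1)r.

   A cut of K by a hyperplane removes from A(r) a strip of C-width r.  Each of the
   two remaining parts of A(r) contains a homothetic copy of A(r), with a centre
   at a point of A(r) farthest from the strip, and the ratios of the copies sum up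
   to at least 1 - r/w, where w is the minimal C-width of A(r).  So a cut decreases
   the sum of the minimal C-widths of the sets A(r) of the pieces by at most r.
   This gives the lower bound, applied with r slightly below the (mn)-th successive
   inradius.  For the equally spaced slices, each piece meets the rounded body in a
   slab of C-width m rho, which bounds its m-th successive inradius by rho. *)

Require Import Defs.
From HB Require Import structures.
From mathcomp Require Import all_boot all_order all_algebra.
From mathcomp Require Import all_classical all_reals all_analysis.
From mathcomp Require Import ring lra.
Import Order.TTheory GRing.Theory Num.Theory.
Import numFieldNormedType.Exports.
Local Open Scope classical_set_scope.
Local Open Scope ring_scope.

(** * Inner products, supporting levels and widths in a direction *)

Section DotProduct.
Context {R : realType} {d : nat}.
Implicit Types (x y u v : 'rV[R]_d) (T : set 'rV[R]_d).

Lemma dotDr u x y : dot u (x + y) = dot u x + dot u y.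
Proof. by rewrite -big_split; apply: eq_bigr => i _; rewrite mxE mulrDr. Qed.

Lemma dotZr u (a : R) x : dot u (a *: x) = a * dot u x.
Proof. by rewrite /dot mulr_sumr; apply: eq_bigr => i _; rewrite mxE mulrCA. Qed.

Lemma dotBr u x y : dot u (x - y) = dot u x - dot u y.
Proof. by rewrite dotDr -scaleN1r dotZr mulN1r. Qed.

Lemma dotC u x : dot u x = dot x u.
Proof. by apply: eq_bigr => i _; rewrite mulrC. Qed.

Lemma dot0l x : dot 0 x = 0.
Proof. by rewrite dotC -(subrr x) dotBr subrr. Qed.

Definition dotE := (dotBr, dotDr, dotZr).

Lemma exists_normal : (0 < d)%N -> exists u : 'rV[R]_d, u != 0.
Proof.
move=> d_gt0; exists (const_mx 1); case: d d_gt0 => // d' _.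
by apply/eqP => /matrixP /(_ 0 0); rewrite !mxE => /eqP; rewrite oner_eq0.
Qed.

Lemma dot_mulmx u x : dot u x = (x *m u^T) ord0 ord0.
Proof. by rewrite mxE; apply: eq_bigr => i _; rewrite mxE mulrC. Qed.

Lemma dot_self_ge0 x : 0 <= dot x x.
Proof. by apply: sumr_ge0 => i _; rewrite -expr2 sqr_ge0. Qed.

Lemma dot_self_gt0 x : x != 0 -> 0 < dot x x.
Proof.
move=> x0; rewrite lt_neqAle dot_self_ge0 andbT eq_sym; apply: contra_neq x0.
move=> /eqP; rewrite psumr_eq0; last by move=> i _; rewrite -expr2 sqr_ge0.
move=> /allP x0; apply/rowP => i; rewrite mxE; apply/eqP.
by have := x0 i (mem_index_enum i); rewrite mulf_eq0 orbb.
Qed.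

Lemma cauchy_schwarz x y : (dot x y) ^+ 2 <= dot x x * dot y y.
Proof.
have [->|x0] := eqVneq x 0; first by rewrite !dot0l expr0n/= mul0r.
have xx := dot_self_gt0 x x0.
(* This is the part of [y] orthogonal to [x], scaled by [dot x x] to avoid a division. *)
have := dot_self_ge0 (dot x x *: y - dot x y *: x).
rewrite dotBr 2!dotZr !(dotC (_ - _)) !dotE (dotC y x).
rewrite (_ : _ - _ = dot x x * (dot x x * dot y y - dot x y ^+ 2)); last by ring.
by rewrite pmulr_rge0// subr_ge0.
Qed.

Lemma continuous_dot u : continuous (dot u).
Proof.
have := @continuous_big R _ +%R 0 xpredT (@add_continuous R) _ (index_enum 'I_d)
  (fun i (x : 'rV[R]_d) => u ord0 i * x ord0 i).
apply=> i _ x; apply: continuousM; first exact: cst_continuous.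
exact: coord_continuous.
Qed.

Lemma compact_supp_max T u : compact T -> T !=set0 ->
  exists2 x, T x & supp_max T u = dot u x /\ (forall y, T y -> dot u y <= dot u x).
Proof.
move=> cT T0; have [x /set_mem Tx xmax] := compact_EVT_max T0 cT
  (continuous_subspaceT (continuous_dot u)).
have {}xmax y : T y -> dot u y <= dot u x by move=> /mem_set/xmax.
exists x => //; split => //; apply/eqP; rewrite eq_le; apply/andP; split.
  by apply: ge_sup => [|_ [y /xmax ? <-]//]; exists (dot u x), x.
by apply: ub_le_sup; [exists (dot u x) => _ [y /xmax ? <-]|exists x].
Qed.

Lemma compact_supp_min T u : compact T -> T !=set0 ->
  exists2 x, T x & supp_min T u = dot u x /\ (forall y, T y -> dot u x <= dot u y).
Proof.
move=> cT T0; have [x /set_mem Tx xmin] := compact_EVT_min T0 cT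
  (continuous_subspaceT (continuous_dot u)).
have {}xmin y : T y -> dot u x <= dot u y by move=> /mem_set/xmin.
exists x => //; split => //; apply/eqP; rewrite eq_le; apply/andP; split.
  by apply: ge_inf; [exists (dot u x) => _ [y /xmin ? <-]|exists x].
by apply: lb_le_inf => [|_ [y /xmin ? <-]//]; exists (dot u x), x.
Qed.

(* The Euclidean width times enorm u; this factor cancels in C-widths. *)
Definition dwidth T u : R := supp_max T u - supp_min T u.

Lemma dwidth_attained T u : compact T -> T !=set0 ->
  exists x y, [/\ T x, T y & dwidth T u = dot u x - dot u y].
Proof.
move=> cT T0; have [x Tx [xE _]] := compact_supp_max T u cT T0.
by have [y Ty [yE _]] := compact_supp_min T u cT T0; exists x, y; rewrite /dwidth xE yE.
Qed.

Lemma le_dwidth T u x y : compact T -> T x -> T y -> dot u x - dot u y <= dwidth T u.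
Proof.
move=> cT Tx Ty; have T0 : T !=set0 by exists x.
have [p Tp [pE pmax]] := compact_supp_max T u cT T0.
have [q Tq [qE qmin]] := compact_supp_min T u cT T0.
by rewrite /dwidth pE qE lerB// ?pmax ?qmin.
Qed.

Lemma dwidth_ge0 T u : compact T -> T !=set0 -> 0 <= dwidth T u.
Proof. by move=> cT [x Tx]; rewrite -(subrr (dot u x)) le_dwidth. Qed.

(** Cauchy-Schwarz bounds all distances between the two hyperplanes from below, and their points on
    the line spanned by [u] attain the bound. *)
Lemma edist_hyperplane u (a b : R) : u != 0 -> a <= b ->
  edist_set (hyperplane u b) (hyperplane u a) = (b - a) / enorm u.
Proof.
move=> u0 ab; have uu := dot_self_gt0 u u0; have u_gt0 : 0 < enorm u by rewrite sqrtr_gt0.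
have uE : enorm u ^+ 2 = dot u u by rewrite sqr_sqrtr ?ltW.
have le_dist r : (exists x y, [/\ hyperplane u b x, hyperplane u a y & r = enorm (x - y)]) ->
    (b - a) / enorm u <= r.
  move=> [x [y [xb ya ->]]]; rewrite ler_pdivrMr//.
  rewrite -(ler_pXn2r (n := 2))// ?nnegrE ?subr_ge0 ?mulr_ge0 ?sqrtr_ge0//.
  rewrite exprMn uE sqr_sqrtr ?dot_self_ge0//.
  by have := cauchy_schwarz (x - y) u; rewrite dotC dotBr xb ya.
have dist_attained : exists x y,
    [/\ hyperplane u b x, hyperplane u a y & (b - a) / enorm u = enorm (x - y)].
  exists ((b / dot u u) *: u), ((a / dot u u) *: u); split.
  - by rewrite /hyperplane/= dotZr divfK// gt_eqF.
  - by rewrite /hyperplane/= dotZr divfK// gt_eqF.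
  rewrite -scalerBl -mulrBl /enorm dotZr dotC dotZr mulrA -expr2 sqrtrM ?sqr_ge0//.
  rewrite sqrtr_sqr ger0_norm ?divr_ge0 ?subr_ge0 ?(ltW uu)//.
  by rewrite -/(enorm u) -uE; field; rewrite gt_eqF.
rewrite /edist_set; apply/eqP; rewrite eq_le; apply/andP; split.
  by apply: (ge_inf _ dist_attained); exists ((b - a) / enorm u) => r; exact: le_dist.
apply: lb_le_inf; first by exists ((b - a) / enorm u).
by move=> r; exact: le_dist.
Qed.

Lemma rel_widthE (C T : set 'rV[R]_d) u : compact C -> C !=set0 -> compact T -> T !=set0 ->
  u != 0 -> rel_width C T u = dwidth T u / dwidth C u.
Proof.
move=> cC C0 cT T0 u0; rewrite /rel_width /width.
rewrite !edist_hyperplane// -1?subr_ge0 ?dwidth_ge0// -/(dwidth T u) -/(dwidth C u).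
have u1 : (enorm u) != 0 by rewrite sqrtr_eq0 -ltNge dot_self_gt0.
by rewrite invf_div mulrA divfK.
Qed.

End DotProduct.

(** * Convex sets and their interiors *)

Section Convexity.
Context {R : realType} {d : nat}.
Implicit Types (x y z u v : 'rV[R]_d) (C S T : set 'rV[R]_d) (t : R).

Lemma convex_setP T : convex_set T <->
  forall t x y, 0 <= t -> t <= 1 -> T x -> T y -> T (t *: x + (1 - t) *: y).
Proof.
split=> [cT t x y t0 t1 Tx Ty|cT x y t /set_mem Tx /set_mem Ty].
  have /set_mem := cT x y (Itv01 t0 t1) (mem_set Tx) (mem_set Ty).
  exact.
by apply/mem_set/cT.
Qed.

Lemma convex_setI S T : convex_set S -> convex_set T -> convex_set (S `&` T).
Proof.
move=> /convex_setP cS /convex_setP cT; apply/convex_setP => t x y t0 t1 [Sx Tx] [Sy Ty].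
by split; [exact: cS|exact: cT].
Qed.

Lemma convex_halfspace_le u (a : R) : convex_set (halfspace_le u a).
Proof.
apply/convex_setP => t x y t0 t1; rewrite /halfspace_le/= !dotE => xa ya.
by nra.
Qed.

Lemma convex_halfspace_ge u (a : R) : convex_set (halfspace_ge u a).
Proof.
apply/convex_setP => t x y t0 t1; rewrite /halfspace_ge/= !dotE => xa ya.
by nra.
Qed.

Lemma closed_halfspace_le u (a : R) : closed (halfspace_le u a).
Proof.
apply: (@preimage_closed _ _ (dot u) [set r | r <= a]); last exact: closed_le.
by move=> x _; exact: continuous_dot.
Qed.

Lemma closed_halfspace_ge u (a : R) : closed (halfspace_ge u a).
Proof.
apply: (@preimage_closed _ _ (dot u) [set r | a <= r]); last exact: closed_ge.
by move=> x _; exact: continuous_dot.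
Qed.

Lemma continuous_affine (a : R) x : continuous (fun w : 'rV[R]_d => a *: w + x).
Proof.
move=> w.
have := @cvgD R 'rV[R]_d _ (nbhs w) (nbhs_filter w) (fun w => a *: w) (fun=> x) (a *: w) x.
apply; last exact: cvg_cst.
exact: scaler_continuous.
Qed.

Lemma continuous_addZ {X : topologicalType} (f : X -> R) (g : X -> 'rV[R]_d) c :
  continuous f -> continuous g -> continuous (fun p => g p + f p *: c).
Proof.
move=> cf cg p.
have := @cvgD R 'rV[R]_d _ (nbhs p) (nbhs_filter p) g (fun p => f p *: c) (g p) (f p *: c).
apply; first exact: cg.
have := @cvgZr_tmp R 'rV[R]_d _ (nbhs p) (nbhs_filter p) f (f p) c.
by apply; exact: cf.
Qed.

(** The homothety with centre [x] and ratio [t] maps the interior of [T] onto an open subset of [T];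
    [f] is its inverse. *)
Lemma convex_interior T x z t : convex_set T -> T x -> T° z -> 0 < t -> t <= 1 ->
  T° (t *: z + (1 - t) *: x).
Proof.
move=> /convex_setP cT Tx Tz t0 t1; have tN0 : t != 0 by rewrite gt_eqF.
pose f w := t^-1 *: w + (- (t^-1 * (1 - t))) *: x.
have fT : f @^-1` T° `<=` T.
  move=> w /interior_subset Tw; have := cT t _ x (ltW t0) t1 Tw Tx.
  by rewrite scalerDr !scalerA mulrN mulrA divff// mul1r scale1r scaleNr subrK.
apply: (filterS fT); apply: open_nbhs_nbhs; split.
  by apply: open_comp => [w _|]; [exact: continuous_affine|exact: open_interior].
rewrite /f/= scalerDr !scalerA mulVf// scale1r -addrA -scalerDl subrr scale0r addr0.
exact: Tz.
Qed.

Lemma interior_fit T C y : T° y -> compact C ->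
  exists2 e : R, 0 < e & forall c, C c -> T (y + e *: c).
Proof.
move=> /nbhs_ballP [r /= r0 rT] cC.
have [M [Mreal MC]] := compact_bounded cC.
pose N := Num.max M 0 + 1.
have NC c : C c -> `|c| <= N.
  by apply: MC; rewrite (le_lt_trans (y := Num.max M 0)) ?le_max ?lexx// ltrDl.
have N0 : 0 < N by rewrite ltr_wpDl// le_max lexx orbT.
(* [N] is only a weak bound on the norms in [C]; the factor 2 keeps the copy inside the open
   ball. *)
exists (r / (N * 2)); first by rewrite divr_gt0// mulr_gt0.
move=> c Cc; apply: rT; rewrite -ball_normE/= opprD addNKr normrN normrZ.
rewrite gtr0_norm ?divr_gt0 ?mulr_gt0// mulrAC ltr_pdivrMr ?mulr_gt0//.
rewrite ltr_pM2l// (le_lt_trans (NC c Cc))//.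
by rewrite mulr_natr mulr2n ltrDl.
Qed.

Lemma dwidth_gt0 C u : convex_body C -> u != 0 -> 0 < dwidth C u.
Proof.
move=> [cC _ [z Cz]] u0.
(* Fitting the singleton of [u] gives a point [z + e *: u] of [C], which is strictly higher than [z]
   in direction [u]. *)
have [e e0 eC] := interior_fit C [set u] z Cz (@compact_set1 _ u).
have := le_dwidth C u _ z cC (eC u erefl) (interior_subset Cz).
by apply: lt_le_trans; rewrite !dotE addrC addKr mulr_gt0// dot_self_gt0.
Qed.

(** The point is a convex combination of the [x + r i] and, with the remaining weight, of [x]. The
    induction splits off one term and divides the other weights by [1 - a i], which the strict bound
    on the sum keeps positive. *)
Lemma convex_comb (I : eqType) (s : seq I) (a : I -> R) (r : I -> 'rV[R]_d) T x :
    convex_set T -> T x -> (forall i, T (x + r i)) -> (forall i, 0 <= a i) ->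
    \sum_(i <- s) a i < 1 ->
  T (x + \sum_(i <- s) a i *: r i).
Proof.
move=> /convex_setP cT Tx Tr; elim: s a => [|i s IHs] a a0.
  by rewrite !big_nil addr0.
rewrite !big_cons => a1.
have ai1 : a i < 1 by apply: le_lt_trans a1; rewrite lerDl sumr_ge0.
have b0 : 0 < 1 - a i by rewrite subr_gt0.
have Ts : T (x + (1 - a i)^-1 *: \sum_(j <- s) a j *: r j).
  rewrite scaler_sumr; under eq_bigr do rewrite scalerA.
  apply: IHs => [j|]; first by rewrite mulr_ge0// invr_ge0 ltW.
  by rewrite -mulr_sumr mulrC ltr_pdivrMr// mul1r ltrBrDl.
have := cT (a i) _ _ (a0 i) (ltW ai1) (Tr i) Ts.
rewrite !scalerDr scalerA divff ?gt_eqF// scale1r addrACA -scalerDl.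
by rewrite subrKC scale1r.
Qed.

(** The rows are found one at a time: some nonzero [v] is orthogonal to the previous rows, and a
    point [y] of [T] with [dot v (y - x)] nonzero yields a further independent row. *)
Lemma exists_row_free T x k : (k <= d)%N -> 
    (forall u, u != 0 -> exists2 y, T y & dot u (y - x) != 0) ->
  exists2 A : 'M[R]_(k, d), row_free A & forall i, T (x + row i A).
Proof.
move=> + Tu; elim: k => [_|k IHk kd].
  by exists 0 => [|[]//]; rewrite /row_free mxrank0.
have [A Af TA] := IHk (ltnW kd).
have /rowV0Pn [v /sub_kermxP vA v0] : kermx A^T != 0.
  by rewrite -mxrank_eq0 mxrank_ker mxrank_tr (eqP Af) subn_eq0 -ltnNge.
have [y Ty yv] := Tu v v0.
rewrite -addn1; exists (col_mx A (y - x)); last first.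
  move=> i; case: (split_ordP i) => j ->; rewrite ?rowKu ?rowKd//.
  by rewrite (_ : row j _ = y - x) ?subrKC//; apply/rowP => l; rewrite mxE ord1.
have Av : A *m v^T = 0 by apply: trmx_inj; rewrite trmx_mul trmxK vA trmx0.
apply: inj_row_free => w; rewrite -[w]hsubmxK mul_row_col => wA.
(* Pairing a vanishing combination of rows with [v] leaves only the new row, so its coefficient is
   0. *)
have w2 : rsubmx w = 0.
  have := congr1 (mulmx^~ v^T) wA; rewrite mul0mx mulmxDl -!mulmxA Av mulmx0 add0r.
  move=> /matrixP /(_ ord0 ord0); rewrite [LHS]mxE [RHS]mxE big_ord1 -dot_mulmx => /eqP.
  rewrite mulf_eq0 (negbTE yv) orbF => /eqP w0.
  by apply/rowP => l; rewrite ord1 w0 mxE.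
move: wA; rewrite w2 mul0mx addr0 => /eqP; rewrite mulmx_free_eq0// => /eqP ->.
by rewrite row_mx0.
Qed.

(** A convex set that lies in no hyperplane contains a simplex with vertex [x] and with the rows of
    [A] as edges; the barycentre [b] of the simplex is interior. *)
Lemma interior_neq0 T : convex_set T -> T !=set0 ->
    (forall u, u != 0 -> exists x y, [/\ T x, T y & dot u y < dot u x]) ->
  T° !=set0.
Proof.
move=> cT [x Tx] Tu.
have [|A Af TA] := exists_row_free T x d (leqnn d).
  (* Of two points at different heights, at least one is not at the height of [x]. *)
  move=> u /Tu [y [z [Ty Tz yz]]]; have [yx|yx] := eqVneq (dot u (y - x)) 0.
    exists z => //; rewrite (_ : z - x = (y - x) - (y - z)) ; last first.
      by rewrite opprB [RHS]addrC subrKA.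
    by rewrite [dot _ _]dotBr yx sub0r oppr_eq0 dotBr subr_eq0 gt_eqF.
  by exists y.
have Au : A \in unitmx by rewrite -row_free_unit.
(* [s w] lists the coordinates of [w - x] with respect to the rows of [A]. At [b] they all equal
   [n1], so they are positive with sum less than 1; both conditions persist near [b]. *)
pose s (w : 'rV[R]_d) := (w - x) *m invmx A.
pose n1 : R := d.+1%:R^-1.
pose b := x + const_mx n1 *m A.
have cmul (B : 'cV[R]_d) : continuous (fun w : 'rV[R]_d => ((w - x) *m B) ord0 ord0).
  rewrite (_ : (fun w => _) = (fun w => dot B^T w - dot B^T x)).
    move=> w; have := @cvgB R R _ (nbhs w) (nbhs_filter w) (dot B^T) (fun=> dot B^T x).
    by apply; [exact: continuous_dot|exact: cvg_cst].
  by apply/funext => w; rewrite -dotBr dot_mulmx trmxK.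
have cs i : continuous (fun w : 'rV[R]_d => s w ord0 i).
  rewrite (_ : (fun w => _) = (fun w : 'rV[R]_d => ((w - x) *m col i (invmx A)) ord0 ord0)).
    exact: cmul.
  by apply/funext => w; rewrite /s !mxE; apply: eq_bigr => j _; rewrite !mxE.
have csum : continuous (fun w : 'rV[R]_d => \sum_i s w ord0 i).
  have -> : (fun w : 'rV[R]_d => \sum_i s w ord0 i) =
      (fun w => ((w - x) *m (invmx A *m (const_mx 1 : 'cV[R]_d))) ord0 ord0).
    by apply/funext => w; rewrite mulmxA mxE; apply: eq_bigr => i _; rewrite [X in _ * X]mxE mulr1.
  exact: cmul.
have sb : s b = const_mx n1 by rewrite /s /b addrC addKr mulmxK.
have s_gt0 : nbhs b [set w | forall i, 0 < s w ord0 i].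
  apply: (@filter_forall _ _ (fun i w => 0 < s w ord0 i) (nbhs b)) => i.
  apply: (@cvgr_gt _ _ (nbhs b) _ _ _ (cs i b)).
  by rewrite sb mxE invr_gt0.
have s_lt1 : nbhs b [set w | \sum_i s w ord0 i < 1].
  apply: (@cvgr_lt _ _ (nbhs b) _ _ _ (csum b)).
  rewrite sb; under eq_bigr do rewrite mxE.
  by rewrite sumr_const card_ord -mulr_natl ltr_pdivrMr// mul1r ltr_nat.
exists b; apply: (@filterS2 _ _ _ _ _ _ _ s_gt0 s_lt1) => w w0 w1.
have := convex_comb _ (index_enum 'I_d) (s w ord0) (fun i => row i A) T x cT Tx TA.
by rewrite -mulmx_sum_row /s mulmxKV// subrKC; apply => // i; exact: ltW.
Qed.
End Convexity.

(** * Cores, and the effect of a cut on their width *)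

Section Cores.
Context {R : realType} {d : nat}.
Variables (C : set 'rV[R]_d) (hC : convex_body C).
Implicit Types (x y z u v : 'rV[R]_d) (K T : set 'rV[R]_d) (r s t l : R).

Let compactC : compact C. Proof. by case: hC. Qed.
Let C_neq0 : C !=set0. Proof. by case: hC => _ _ [x /interior_subset]; exists x. Qed.

(** The set A(r) of the overview, that is, the Minkowski difference of [K] and rC. *)
Definition core K r : set 'rV[R]_d := [set x | homothet r C x `<=` K].

Lemma coreP K r x : core K r x <-> forall c, C c -> K (x + r *: c).
Proof.
split=> [Kx c Cc|Kx _ [c Cc <-]]; last exact: Kx.
by apply: Kx; exists c.
Qed.

(** Averaging [x + s *: c] and [y + r *: c] for the same [c] averages the radii too. *)
Lemma core_concave K r s t x y : convex_set K -> 0 <= t -> t <= 1 ->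
  core K s x -> core K r y -> core K (t * s + (1 - t) * r) (t *: x + (1 - t) *: y).
Proof.
move=> /convex_setP cK t0 t1 /coreP Kx /coreP Ky; apply/coreP => c Cc.
have := cK t _ _ t0 t1 (Kx c Cc) (Ky c Cc).
by rewrite !scalerDr !scalerA addrACA -scalerDl.
Qed.

(** For positive [s], the point [x + (s - r) *: c + r *: c'] is [x] plus [s] times the convex
    combination of [c'] and [c] with weights [r / s] and [1 - r / s]. *)
Lemma core_shrink K r s x c : 0 <= r -> r <= s -> C c ->
  core K s x -> core K r (x + (s - r) *: c).
Proof.
case: hC => _ /convex_setP cC _ r0 rs Cc /coreP Kx; apply/coreP => c' Cc'.
have [s0|s0] := eqVneq s 0.
  have -> : r = 0 by apply/eqP; rewrite eq_le r0 andbT -s0.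
  by have := Kx c Cc; rewrite s0 subrr !scale0r !addr0.
have s_gt0 : 0 < s by rewrite lt_neqAle eq_sym s0 (le_trans r0).
have := Kx _ (cC (r / s) _ _ _ _ Cc' Cc).
rewrite divr_ge0 ?(ltW s_gt0)// ler_pdivrMr// mul1r => /(_ isT rs).
rewrite scalerDr !scalerA mulrBr mulr1 [s * _]mulrC divfK//.
by rewrite addrAC addrA.
Qed.

(** The core is an intersection of translates of [K], hence closed, and lies in one of these compact
    translates. *)
Lemma compact_core K r : compact K -> compact (core K r).
Proof.
move=> cK; have [c0 Cc0] := C_neq0.
have clK : closed K by apply: compact_closed => //; exact: norm_hausdorff.
apply: (@subclosed_compact _ _ [set 1 *: x - r *: c0 | x in K]).
- rewrite (_ : core K r = \bigcap_(c in C) ((fun x => 1 *: x + r *: c) @^-1` K)).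
    apply: closed_bigI => c _; apply: preimage_closed => // x _.
    exact: continuous_affine.
  apply/seteqP; split => x.
    by move=> /coreP Kx c /Kx; rewrite /= scale1r.
  by move=> Kx; apply/coreP => c /Kx/=; rewrite scale1r.
- by apply: continuous_compact => //; apply: continuous_subspaceT; exact: continuous_affine.
by move=> x /coreP/(_ c0 Cc0) Kx; exists (x + r *: c0); rewrite // scale1r addrK.
Qed.

(* Equivalently: the C-width of T is at least l and T is nonempty, but no
   infimum or supremum over T is involved. *)
Definition wide l T := forall u, exists x y, [/\ T x, T y & l * dwidth C u <= dot u x - dot u y].

Lemma wideP l T : compact T -> T !=set0 ->
  wide l T <-> forall u, u != 0 -> l * dwidth C u <= dwidth T u.
Proof.
move=> cT T0; split=> [wT u _|wT u].
  by have [x [y [Tx Ty /le_trans]]] := wT u; apply; exact: le_dwidth.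
have [x [y [Tx Ty dE]]] := dwidth_attained T u cT T0; exists x, y; split => //.
have [->|u0] := eqVneq u 0; last by rewrite -dE wT.
rewrite !dot0l subrr; case: C_neq0 => c Cc.
have [p [q [_ _ ->]]] := dwidth_attained C 0 compactC C_neq0.
by rewrite !dot0l subrr mulr0.
Qed.

Lemma wide_sub l S T : S `<=` T -> wide l S -> wide l T.
Proof. by move=> ST wS u; have [x [y [/ST Tx /ST Ty xy]]] := wS u; exists x, y. Qed.

Lemma wide_interior l T : convex_set T -> 0 < l -> wide l T -> T° !=set0.
Proof.
move=> cT l0 wT; apply: interior_neq0 => //.
  by have [x [_ [Tx _ _]]] := wT 0; exists x.
move=> u u0; have [x [y [Tx Ty xy]]] := wT u; exists x, y; split => //.
by rewrite -subr_gt0 (lt_le_trans _ xy)// mulr_gt0// dwidth_gt0.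
Qed.

Lemma convex_core K r : convex_set K -> convex_set (core K r).
Proof.
move=> cK; apply/convex_setP => t x y t0 t1 Kx Ky.
by have := core_concave K r r t x y cK t0 t1 Kx Ky; rewrite -mulrDl subrKC mul1r.
Qed.

(** The whole core at radius [r] is contracted towards the single point [x]; this scales widths by
    [1 - t] and averages the radii. *)
Lemma wide_core_concave K l r s t x : convex_set K -> 0 <= t -> t <= 1 ->
  core K s x -> wide l (core K r) -> wide ((1 - t) * l) (core K (t * s + (1 - t) * r)).
Proof.
move=> cK t0 t1 Kx wK u; have [y [z [Ky Kz yz]]] := wK u.
exists (t *: x + (1 - t) *: y), (t *: x + (1 - t) *: z); split.
- exact: core_concave.
- exact: core_concave.
rewrite !dotE; have : (1 - t) * (l * dwidth C u) <= (1 - t) * (dot u y - dot u z).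
  by rewrite ler_wpM2l// subr_ge0.
by rewrite mulrA => /le_trans; apply; lra.
Qed.

(** The core at [r] contains the core at [s] enlarged by [s - r] times [C], and widths of Minkowski
    sums add. *)
Lemma wide_core_shrink K l r s : 0 <= r -> r <= s ->
  wide l (core K s) -> wide (l + (s - r)) (core K r).
Proof.
move=> r0 rs wK u; have [x [y [Kx Ky xy]]] := wK u.
have [c [c' [Cc Cc' cE]]] := dwidth_attained C u compactC C_neq0.
exists (x + (s - r) *: c), (y + (s - r) *: c'); split.
- exact: core_shrink.
- exact: core_shrink.
by rewrite mulrDl !dotE opprD addrACA -mulrBr -cE lerD2r.
Qed.

Lemma wide_homothety l t T p : 0 <= t -> wide l T ->
  wide (t * l) [set t *: x + (1 - t) *: p | x in T].
Proof.
move=> t0 wT u; have [x [y [Tx Ty xy]]] := wT u.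
exists (t *: x + (1 - t) *: p), (t *: y + (1 - t) *: p); split.
- by exists x.
- by exists y.
by rewrite !dotE opprD addrACA subrr addr0 -mulrBr -mulrA ler_wpM2l.
Qed.

(** [t] is [a] truncated to the unit interval. The guard on [t <= a] allows for negative [a], which
    is raised to 0. *)
Let clip (a : R) : exists t, [/\ 0 <= t, t <= 1, 0 < t -> t <= a & t = 1 \/ a <= t].
Proof.
have [a0|a0] := leP a 0; first by exists 0; split => //; [rewrite ltxx|right].
have [a1|a1] := leP 1 a; first by exists 1; split => //; left.
by exists a; split; [exact: ltW|exact: ltW| |right].
Qed.

(* Shrinking the core of K towards its points of least and of greatest height
   over the cut yields homothetic copies inside the cores of the two parts. *)
Lemma wide_core_cut K l r u (a : R) : compact K -> convex_set K -> u != 0 ->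
    0 <= r -> 0 <= l -> wide l (core K r) ->
  exists l1 l2, [/\ 0 <= l1 /\ (0 < l1 -> wide l1 (core (K `&` halfspace_le u a) r)),
    0 <= l2 /\ (0 < l2 -> wide l2 (core (K `&` halfspace_ge u a) r)) &
    l <= l1 + l2 + r].
Proof.
move=> cK convK u0 r0 l0 wT; set T := core K r in wT.
have cT : compact T by exact: compact_core.
have convT : convex_set T by exact: convex_core.
have T0 : T !=set0 by have [x [_ [Tx _ _]]] := wT 0; exists x.
have w0 := dwidth_gt0 C u hC u0; set w := dwidth C u in w0.
have [p Tp [_ pmin]] := compact_supp_min T u cT T0.
have [q Tq [_ qmax]] := compact_supp_max T u cT T0.
have [c Cc [cE cmax]] := compact_supp_max C u compactC C_neq0.
have [c' Cc' [c'E c'min]] := compact_supp_min C u compactC C_neq0.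
have wE : w = dot u c - dot u c' by rewrite -cE -c'E.
pose D := dot u q - dot u p.
have lD : l * w <= D.
  have [x [y [Tx Ty /le_trans]]] := wT u; apply.
  by rewrite lerB// ?pmin ?qmax.
(* Here [l * w <= D <= 0] forces [l <= 0], so zero widths suffice. *)
have [D0|D0] := leP D 0.
  exists 0, 0; rewrite !lexx !ltxx; split => //; rewrite !add0r.
  by rewrite (le_trans _ r0)// -(pmulr_lle0 _ w0) (le_trans lD).
(* The copy of rC placed at [x] stays below the cut if [x] has height at most [b], and above it if
   the height is at least [b']. The lost strip has height [b' - b = r * w]. *)
pose b := a - r * dot u c; pose b' := a - r * dot u c'.
have T1 x : T x -> dot u x <= b -> core (K `&` halfspace_le u a) r x.
  move=> /coreP Kx xb; apply/coreP => z Cz; split; first exact: Kx.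
  rewrite /halfspace_le/= !dotE; have := ler_wpM2l r0 (cmax z Cz).
  by move: xb; rewrite /b; lra.
have T2 x : T x -> b' <= dot u x -> core (K `&` halfspace_ge u a) r x.
  move=> /coreP Kx xb; apply/coreP => z Cz; split; first exact: Kx.
  rewrite /halfspace_ge/= !dotE; have := ler_wpM2l r0 (c'min z Cz).
  by move: xb; rewrite /b'; lra.
(* The copy of [T] contracted towards [p] reaches up to height [dot u p + t * D]. So [t] is the
   greatest ratio in the unit interval that keeps it at height at most [b], or 0 if there is none;
   [s] is the analogue at [q]. *)
have [t [t0 t1 tb bt]] := clip ((b - dot u p) / D).
have [s [s0 s1 sb bs]] := clip ((dot u q - b') / D).
exists (t * l), (s * l); split.
- split=> [|tl]; first exact: mulr_ge0.
  apply: wide_sub (wide_homothety l t T p t0 wT) => _ [x Tx <-].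
  have {}tb : t * D <= b - dot u p.
    rewrite -ler_pdivlMr// tb// lt_neqAle t0 andbT eq_sym.
    by apply: contraTneq tl => ->; rewrite mul0r ltxx.
  apply: T1; first by move/convex_setP: convT; exact.
  rewrite !dotE; have := ler_wpM2l t0 (qmax x Tx); move: tb; rewrite /D; lra.
- split=> [|sl]; first exact: mulr_ge0.
  apply: wide_sub (wide_homothety l s T q s0 wT) => _ [x Tx <-].
  have {}sb : s * D <= dot u q - b'.
    rewrite -ler_pdivlMr// sb// lt_neqAle s0 andbT eq_sym.
    by apply: contraTneq sl => ->; rewrite mul0r ltxx.
  apply: T2; first by move/convex_setP: convT; exact.
  rewrite !dotE; have := ler_wpM2l s0 (pmin x Tx); move: sb; rewrite /D; lra.
have tl0 := mulr_ge0 t0 l0; have sl0 := mulr_ge0 s0 l0.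
case: bt => [->|bt]; first by rewrite mul1r -addrA lerDl addr_ge0.
case: bs => [->|bs]; first by rewrite mul1r addrAC lerDr addr_ge0.
(* In the remaining case the ratios add up to at least [1 - r * w / D]. After multiplication by [l]
   the loss is at most [r], because [l * w <= D]. *)
have : D - r * w <= (t + s) * D.
  move: bt bs; rewrite !ler_pdivrMr// wE /b /b' /D; lra.
move=> /(ler_wpM2l l0) tsD.
have rlD := ler_wpM2l r0 lD.
rewrite -(ler_pM2r D0); move: tsD rlD; lra.
Qed.

(* The value 0 is allowed for every set, so that an empty core has width 0. *)
Definition core_width K r : R := sup [set l | 0 <= l /\ (0 < l -> wide l (core K r))].

Lemma core_width_adherent K r l : 0 <= l -> l < core_width K r ->
  exists2 l', l < l' & wide l' (core K r).
Proof.
move=> l0; rewrite /core_width => lt; have := lt; set E := (X in sup X) in lt *.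
have E0 : E !=set0 by exists 0; split; rewrite ?ltxx.
(* Without a supremum, [sup] takes its default value 0, and no [l >= 0] lies below it. *)
have [hE|/sup_out ->] := pselect (has_sup E); last by rewrite ltNge l0.
move=> _; have [|l' [_ wl'] ll'] := @sup_adherent _ E (sup E - l) _ hE.
  by rewrite subr_gt0.
by move: ll'; rewrite subKr => ll'; exists l' => //; apply: wl'; exact: le_lt_trans ll'.
Qed.

Hypothesis d_gt0 : (0 < d)%N.

Lemma core_width_ub K r : compact K ->
  has_ubound [set l | 0 <= l /\ (0 < l -> wide l (core K r))].
Proof.
move=> cK; have [u u0] := @exists_normal R d d_gt0; have w0 := dwidth_gt0 C u hC u0.
have cT := compact_core K r cK.
exists (Num.max 0 (dwidth (core K r) u / dwidth C u)) => l [l0 wl].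
rewrite le_max; have [//|{}/wl wl] := leP l 0.
rewrite ler_pdivlMr//; have [x [y [Tx Ty /le_trans]]] := wl u; apply.
exact: le_dwidth.
Qed.

Lemma core_width_cut K r u (a : R) : compact K -> convex_set K -> u != 0 -> 0 <= r ->
  core_width K r <=
  core_width (K `&` halfspace_le u a) r + core_width (K `&` halfspace_ge u a) r + r.
Proof.
move=> cK convK u0 r0.
have cK1 : compact (K `&` halfspace_le u a).
  by apply: compact_closedI => //; exact: closed_halfspace_le.
have cK2 : compact (K `&` halfspace_ge u a).
  by apply: compact_closedI => //; exact: closed_halfspace_ge.
have ub1 := ub_le_sup (core_width_ub _ r cK1).
have ub2 := ub_le_sup (core_width_ub _ r cK2).
apply: ge_sup => [|l [l0 wl]]; first by exists 0; split; rewrite ?ltxx.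
have [l_le0|{}/wl wl] := leP l 0.
  by rewrite (le_trans l_le0)// !addr_ge0// ?ub1 ?ub2//; split; rewrite ?ltxx.
have [l1 [l2 [wl1 wl2 /le_trans]]] := wide_core_cut K l r u a cK convK u0 r0 l0 wl.
by apply; rewrite lerD2r lerD// ?ub1 ?ub2.
Qed.

End Cores.

(** * Existence and comparison of core radii *)

Section SuccessiveInradius.
Context {R : realType} {d : nat}.
Variables (C : set 'rV[R]_d) (hC : convex_body C).
Implicit Types (x y z u v : 'rV[R]_d) (K T : set 'rV[R]_d) (r s t l k : R).

Let compactC : compact C. Proof. by case: hC. Qed.
Let C_neq0 : C !=set0. Proof. by case: hC => _ _ [x /interior_subset]; exists x. Qed.
Hypothesis d_gt0 : (0 < d)%N.

(* is_core_radius K (m%:R - 1) r says that r is the m-th successive C-inradius of K. *)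
Definition is_core_radius K k r :=
  [/\ 0 < r, wide C (k * r) (core C K r) & forall l, wide C l (core C K r) -> l <= k * r].

(** If [s] exceeded [r], shrinking the radius from [s] to [r] would add [s - r] to a width that is
    already at least [k * s], exceeding the maximum [k * r]. *)
Lemma wide_core_radius K k l r s : 0 <= k -> is_core_radius K k r ->
  wide C l (core C K s) -> k * s <= l -> s <= r.
Proof.
move=> k0 [r0 _ rmax] wl ksl; rewrite leNgt; apply/negP => rs.
have /rmax := wide_core_shrink C hC K l r s (ltW r0) (ltW rs) wl.
by have := ler_wpM2l k0 (ltW rs); lra.
Qed.

Lemma radius_bounded K u r x : compact K -> 0 <= r -> u != 0 -> core C K r x ->
  r <= dwidth K u / dwidth C u.
Proof.
move=> cK r0 u0 /coreP Kx; rewrite ler_pdivlMr ?dwidth_gt0//.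
have [c [c' [Cc Cc' ->]]] := dwidth_attained C u compactC C_neq0.
have := le_dwidth K u _ _ cK (Kx c Cc) (Kx c' Cc').
by rewrite !dotE; lra.
Qed.

(** For a fixed direction, the radii in [E] and their shifted witnesses lie in a compact set [F].
    Its projection to the radii is closed, so it contains [sup E], and the witnesses for [sup E] are
    read off from [F]. *)
Lemma wide_sup K k : compact K -> 0 <= k ->
  let E := [set r | 0 < r /\ wide C (k * r) (core C K r)] in
  E !=set0 -> has_ubound E -> E (sup E).
Proof.
move=> cK k0 E E0 ubE; have [c0 Cc0] := C_neq0.
have clK : closed K by apply: compact_closed => //; exact: norm_hausdorff.
have supE0 : 0 < sup E.
  by have [r Er] := E0; apply: lt_le_trans (ub_le_sup ubE Er); case: Er.
split=> // u.
(* The shift by c0 keeps the points x and y inside K. *)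
pose b := sup E.
pose F : set (R * ('rV[R]_d * 'rV[R]_d)) := (`[0, b] `*` (K `*` K)) `&`
  ((\bigcap_(c in C) ((fun p => p.2.1 + p.1 *: (c - c0)) @^-1` K)) `&`
   (\bigcap_(c in C) ((fun p => p.2.2 + p.1 *: (c - c0)) @^-1` K)) `&`
   ((fun p => k * p.1 * dwidth C u + dot u p.2.2 - dot u p.2.1) @^-1` [set a | a <= 0])).
have cfst : continuous (fun p : R * ('rV[R]_d * 'rV[R]_d) => p.1) by move=> p; exact: cvg_fst.
have csnd1 : continuous (fun p : R * ('rV[R]_d * 'rV[R]_d) => p.2.1).
  move=> p; apply: (@continuous_comp _ _ _ snd fst); [exact: cvg_snd|exact: cvg_fst].
have csnd2 : continuous (fun p : R * ('rV[R]_d * 'rV[R]_d) => p.2.2).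
  move=> p; apply: (@continuous_comp _ _ _ snd snd); [exact: cvg_snd|exact: cvg_snd].
have cF : compact F.
  apply: compact_closedI.
    by apply: compact_setX; [exact: segment_compact|exact: compact_setX].
  apply: closedI; [apply: closedI|].
  - apply: closed_bigI => c _; apply: preimage_closed => // p _.
    exact: (continuous_addZ _ _ _ cfst csnd1).
  - apply: closed_bigI => c _; apply: preimage_closed => // p _.
    exact: (continuous_addZ _ _ _ cfst csnd2).
  apply: preimage_closed => [p _|]; last exact: closed_le.
  have := @cvgB R R _ (nbhs p) (nbhs_filter p)
    (fun p => k * p.1 * dwidth C u + dot u p.2.2) (fun p => dot u p.2.1).
  apply.
    have := @cvgD R R _ (nbhs p) (nbhs_filter p)
      (fun p => k * p.1 * dwidth C u) (fun p => dot u p.2.2).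
    apply.
      have := @cvgM R _ (nbhs p) (nbhs_filter p) (fun p => k * p.1) (fun=> dwidth C u).
      apply; last exact: cvg_cst.
      have := @cvgM R _ (nbhs p) (nbhs_filter p) (fun=> k) (fun p => p.1).
      apply; [exact: cvg_cst|exact: cvg_fst].
    by apply: (@continuous_comp _ _ _ (fun p => p.2.2) (dot u)); [exact: csnd2|exact: continuous_dot].
  by apply: (@continuous_comp _ _ _ (fun p => p.2.1) (dot u)); [exact: csnd1|exact: continuous_dot].
have shiftE r x c : x + r *: c0 + r *: (c - c0) = x + r *: c.
  by rewrite scalerBr -addrA subrKC.
have EF : E `<=` fst @` F.
  move=> r Er; have [r0 /(_ u) [x [y [/coreP Kx /coreP Ky xy]]]] := Er.
  exists (r, (x + r *: c0, y + r *: c0)) => //; split; first split.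
  - by rewrite /= in_itv/= (ltW r0) ub_le_sup.
  - by split; [exact: Kx|exact: Ky].
  split; first split.
  - by move=> c Cc; rewrite /= shiftE; exact: Kx.
  - by move=> c Cc; rewrite /= shiftE; exact: Ky.
  by move: xy; rewrite /= !dotE; lra.
have clF : closed (fst @` F).
  apply: compact_closed; first exact: norm_hausdorff.
  by apply: continuous_compact => //; exact: continuous_subspaceT.
have [[r [x y]] /= [_ [[Kx Ky] /= xy]] rE] : (fst @` F) (sup E).
  by apply: clF; apply: closure_subset EF _ _; exact: closure_sup.
rewrite -rE; exists (x - r *: c0), (y - r *: c0); split.
- by apply/coreP => c Cc; rewrite -shiftE subrK; exact: Kx.
- by apply/coreP => c Cc; rewrite -shiftE subrK; exact: Ky.
by move: xy; rewrite !dotE; lra.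
Qed.

(** The radius is the supremum of [E]. If its core were wider than required, that core would have an
    interior point, about which a larger copy of [C] fits into [K]; by concavity, mixing the two
    would give a member of [E] beyond the supremum. *)
Lemma exists_core_radius K k : convex_body K -> 0 <= k -> exists r, is_core_radius K k r.
Proof.
move=> [cK convK [z Kz]] k0; have [u u0] := @exists_normal R d d_gt0.
pose E := [set r | 0 < r /\ wide C (k * r) (core C K r)].
have k1 : 0 < k + 1 by rewrite ltr_wpDl.
have E0 : E !=set0.
  have [e e0 /coreP Ke] := interior_fit K C z Kz compactC.
  have r0 : 0 < e / (k + 1) by rewrite divr_gt0.
  have re : e / (k + 1) <= e by rewrite ler_pdivrMr// ler_peMr ?(ltW e0)// lerDr.
  (* Shrinking the radius from [e] to this value gains the width [e - e / (k + 1)], which is exactly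
     [k] times the new radius. *)
  exists (e / (k + 1)); split => //.
  have w0 : wide C 0 (core C K e) by move=> v; exists z, z; rewrite subrr mul0r.
  have := wide_core_shrink C hC K 0 _ e (ltW r0) re w0.
  by rewrite add0r (_ : e - _ = k * (e / (k + 1)))//; field; rewrite gt_eqF.
have ubE : has_ubound E.
  exists (dwidth K u / dwidth C u) => r [r0 /(_ u) [x [_ [Kx _ _]]]].
  exact: radius_bounded cK (ltW r0) u0 Kx.
have [r0 wr] := wide_sup K k cK k0 E0 ubE.
exists (sup E); split => // l wl; rewrite leNgt; apply/negP => kl.
set r := sup E in r0 wr wl kl.
have l0 : 0 < l by apply: le_lt_trans kl; rewrite mulr_ge0// ltW.
have [y Ky] := wide_interior C hC l _ (convex_core C K r convK) l0 wl.
have [e e0 Ke] := interior_fit _ C y Ky compactC.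
have {}Ke : core C K (r + e) y.
  apply/coreP => c Cc; have /coreP/(_ c Cc) := Ke c Cc.
  by rewrite -addrA -scalerDl addrC [e + r]addrC addrC.
(* This [t] solves [(1 - t) * l = k * (r + t * e)], so the mixed core is just wide enough for its
   radius. *)
pose t := (l - k * r) / (l + k * e).
have lke : 0 < l + k * e by rewrite ltr_pwDl// mulr_ge0// ltW.
have t0 : 0 < t by rewrite divr_gt0// subr_gt0.
have t1 : t <= 1.
  rewrite ler_pdivrMr// mul1r; have := mulr_ge0 k0 (ltW e0); have := mulr_ge0 k0 (ltW r0); lra.
have := wide_core_concave C K l r (r + e) t y convK (ltW t0) t1 Ke wl.
have -> : t * (r + e) + (1 - t) * r = r + t * e by ring.
have -> : (1 - t) * l = k * (r + t * e) by rewrite /t; field; rewrite gt_eqF.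
move=> wt; have : r + t * e <= r.
  by apply: ub_le_sup => //; split => //; rewrite addr_gt0// mulr_gt0.
by rewrite gerDl leNgt mulr_gt0.
Qed.

End SuccessiveInradius.

(** * Widths of rounded bodies and directions of minimal width *)

Section MinimalWidth.
Context {R : realType} {d : nat}.
Variables (C : set 'rV[R]_d) (hC : convex_body C).
Implicit Types (x y z u v : 'rV[R]_d) (K T : set 'rV[R]_d) (r s t l k : R).

Let compactC : compact C. Proof. by case: hC. Qed.
Let C_neq0 : C !=set0. Proof. by case: hC => _ _ [x /interior_subset]; exists x. Qed.

Lemma rounded_bodyE K r :
  rounded_body C K r = [set p.1 + r *: p.2 | p in core C K r `*` C].
Proof.
apply/seteqP; split => z.
  by move=> [x Kx [c Cc <-]]; exists (x, c).
by move=> [[x c] [/= Kx Cc] <-]; exists x => //; exists c.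
Qed.

Lemma rounded_body_sub K r : rounded_body C K r `<=` K.
Proof. by move=> z [x Kx /Kx]. Qed.

Lemma core_rounded_body K r x c : core C K r x -> C c -> rounded_body C K r (x + r *: c).
Proof. by move=> Kx Cc; exists x => //; exists c. Qed.

Lemma rounded_body_neq0 K r : core C K r !=set0 -> rounded_body C K r !=set0.
Proof.
by case: C_neq0 => c Cc [x Kx]; exists (x + r *: c); exact: core_rounded_body.
Qed.

Lemma compact_rounded_body K r : compact K -> compact (rounded_body C K r).
Proof.
move=> cK; rewrite rounded_bodyE; apply: continuous_compact; last first.
  by apply: compact_setX => //; exact: compact_core.
apply: continuous_subspaceT => p.
have := @cvgD R 'rV[R]_d _ (nbhs p) (nbhs_filter p) fst (fun p => r *: p.2) p.1 (r *: p.2).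
apply; first exact: cvg_fst.
have := @cvgZl_tmp R 'rV[R]_d _ (nbhs p) (nbhs_filter p) r snd p.2.
by apply; exact: cvg_snd.
Qed.

(** The rounded body is the Minkowski sum of the core and rC, and widths add. *)
Lemma dwidth_rounded_body K r u : compact K -> 0 <= r -> core C K r !=set0 ->
  dwidth (rounded_body C K r) u = dwidth (core C K r) u + r * dwidth C u.
Proof.
move=> cK r0 K0; have cT := compact_core C hC K r cK.
have cL := compact_rounded_body K r cK.
apply/eqP; rewrite eq_le; apply/andP; split.
  have [z [z' [Lz Lz' ->]]] := dwidth_attained _ u cL (rounded_body_neq0 _ _ K0).
  have [x Kx [c Cc <-]] := Lz; have [x' Kx' [c' Cc' <-]] := Lz'.
  rewrite !dotE opprD addrACA -mulrBr.
  by rewrite lerD// ?ler_wpM2l// le_dwidth.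
have [x [y [Kx Ky ->]]] := dwidth_attained _ u cT K0.
have [c [c' [Cc Cc' ->]]] := dwidth_attained _ u compactC C_neq0.
have := le_dwidth _ u _ _ cL (core_rounded_body K r x c Kx Cc) (core_rounded_body K r y c' Ky Cc').
by rewrite !dotE; lra.
Qed.

Lemma rel_width_rounded_body K r u : compact K -> 0 <= r -> core C K r !=set0 -> u != 0 ->
  rel_width C (rounded_body C K r) u = dwidth (core C K r) u / dwidth C u + r.
Proof.
move=> cK r0 K0 u0; rewrite rel_widthE//.
- by rewrite dwidth_rounded_body// mulrDl mulfK// gt_eqF// dwidth_gt0.
- exact: compact_rounded_body.
- exact: rounded_body_neq0.
Qed.

Hypothesis d_gt0 : (0 < d)%N.

Lemma wide_min_rel_width K r l : compact K -> 0 <= r -> core C K r !=set0 ->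
  wide C l (core C K r) <-> l + r <= min_rel_width C (rounded_body C K r).
Proof.
move=> cK r0 K0; rewrite wideP//; last exact: compact_core.
have relE u : u != 0 -> (l * dwidth C u <= dwidth (core C K r) u) =
    (l + r <= rel_width C (rounded_body C K r) u).
  by move=> u0; rewrite rel_width_rounded_body// lerD2r ler_pdivlMr// dwidth_gt0.
split=> [wl|wl u u0].
  apply: lb_le_inf => [|_ [u u0 <-]]; last by rewrite -relE ?wl.
  by have [u u0] := @exists_normal R d d_gt0; exists (rel_width C (rounded_body C K r) u), u.
rewrite relE// (le_trans wl)//; apply: ge_inf; last by exists u.
exists 0 => _ [v v0 <-]; rewrite rel_width_rounded_body// addr_ge0// divr_ge0//.
  by apply: dwidth_ge0 => //; exact: compact_core.
by rewrite ltW// dwidth_gt0.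
Qed.

(** [sup] and [inf] of the empty set default to 0, so the two supporting hyperplanes coincide. This
    excludes empty cores from the equation that defines the successive inradius. *)
Lemma min_rel_width0 : min_rel_width C set0 = 0.
Proof.
have rel0 u : u != 0 -> rel_width C set0 u = 0.
  move=> u0; rewrite /rel_width /width /supp_max /supp_min image_set0 sup0 inf0.
  by rewrite edist_hyperplane// subrr !mul0r.
rewrite /min_rel_width (_ : [set _ | _ in _] = [set 0]) ?inf1//.
apply/seteqP; split=> [_ [u u0 <-]|_ ->]; first exact: rel0.
by have [u u0] := @exists_normal R d d_gt0; exists u => //; exact: rel0.
Qed.

(** Rounding adds [r] to the minimal width of the core, which turns [(m%:R - 1) * r] into
    [m%:R * r]; a point of the core shows that [r] is at most the inradius. *)
Lemma min_rel_width_core_radius K r (m : nat) : convex_body K -> (0 < m)%N ->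
  0 < r <= inradius C K /\ min_rel_width C (rounded_body C K r) = m%:R * r <->
  is_core_radius C K (m%:R - 1) r.
Proof.
move=> [cK _ _] m0; have mE : m%:R * r = (m%:R - 1) * r + r by ring.
split=> [[/andP[r0 _]]|[r0 wr rmax]].
  have [K0|K0] := pselect (core C K r !=set0); last first.
    have -> : rounded_body C K r = set0.
      by apply/seteqP; split=> // z [x Kx _]; case: K0; exists x.
    rewrite min_rel_width0 => /esym/eqP.
    by rewrite mulf_eq0 pnatr_eq0 (gtn_eqF m0) gt_eqF.
  move=> mrE; have wideE l := wide_min_rel_width K r l cK (ltW r0) K0.
  split=> // [|l /wideE]; first by apply/wideE; rewrite mrE -mE.
  by rewrite mrE mE lerD2r.
have [x [_ [Kx _ _]]] := wr 0; have K0 : core C K r !=set0 by exists x.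
have wideE l := wide_min_rel_width K r l cK (ltW r0) K0.
split.
  rewrite r0/=; have [u u0] := @exists_normal R d d_gt0.
  apply: ub_le_sup; last by split => //; exists x.
  exists (dwidth K u / dwidth C u) => s [s0 [y Ky]].
  exact: radius_bounded cK (ltW s0) u0 Ky.
rewrite mE; apply/eqP; rewrite eq_le; apply/andP; split; last exact/wideE.
by rewrite -lerBlDr; apply: rmax; apply/wideE; rewrite subrK.
Qed.

Lemma succ_inradius_core_radius K (m : nat) : convex_body K -> (0 < m)%N ->
  is_core_radius C K (m%:R - 1) (succ_inradius C K m).
Proof.
move=> hK m0; apply/min_rel_width_core_radius => //; rewrite /succ_inradius.
set P := (X in xget _ X); suff : P (xget 0 P) by [].
(* The core radius found next satisfies [P], so [xget] does not return its default 0. *)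
apply: xgetPex.
have [|r /min_rel_width_core_radius rP] := exists_core_radius C hC d_gt0 K (m%:R - 1) hK.
  by rewrite subr_ge0 ler1n.
by exists r; exact: rP.
Qed.

Lemma dwidthZ T u (a : R) : compact T -> T !=set0 -> 0 <= a ->
  dwidth T (a *: u) = a * dwidth T u.
Proof.
move=> cT T0 a0; apply/eqP; rewrite eq_le; apply/andP; split.
  have [x [y [Tx Ty ->]]] := dwidth_attained T (a *: u) cT T0.
  by rewrite ![dot (_ *: _) _]dotC !dotZr -mulrBr ler_wpM2l// ![dot _ u]dotC le_dwidth.
have [x [y [Tx Ty ->]]] := dwidth_attained T u cT T0.
have := le_dwidth T (a *: u) x y cT Tx Ty.
by rewrite ![dot (_ *: _) _]dotC !dotZr -mulrBr ![dot _ u]dotC.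
Qed.

Lemma norm_dot_le u x : `|dot u x| <= d%:R * `|u| * `|x|.
Proof.
have coord_le z i : `|z ord0 i| <= `|z|.
  rewrite [leRHS]/Num.norm/= mx_normrE.
  exact: (le_bigmax _ (fun ij => `|z ij.1 ij.2|) (ord0, i)).
rewrite /dot (le_trans (ler_norm_sum _ _ _))//.
rewrite -mulrA mulr_natl -[X in _ *+ X]card_ord -sumr_const ler_sum// => i _.
by rewrite normrM ler_pM.
Qed.

(** Since [T] is bounded, its width is Lipschitz in the direction, with constant [A]. *)
Lemma continuous_dwidth T : compact T -> T !=set0 -> continuous (dwidth T).
Proof.
move=> cT T0.
have [M [Mreal MT]] := compact_bounded cT.
pose N := Num.max M 0 + 1.
have NT x : T x -> `|x| <= N.
  by apply: MT; rewrite (le_lt_trans (y := Num.max M 0)) ?le_max ?lexx// ltrDl.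
have N0 : 0 < N by rewrite ltr_wpDl// le_max lexx orbT.
pose A := 2 * (d%:R * N).
have A0 : 0 < A by rewrite !mulr_gt0// ltr0n.
have lip u v : dwidth T u <= dwidth T v + A * `|u - v|.
  have [x [y [Tx Ty ->]]] := dwidth_attained T u cT T0.
  have := le_dwidth T v x y cT Tx Ty.
  have bd z : T z -> `|dot (u - v) z| <= d%:R * N * `|u - v|.
    move=> Tz; rewrite (le_trans (norm_dot_le _ _))// mulrAC ler_wpM2r//.
    by rewrite ler_wpM2l// NT.
  have := bd x Tx; have := bd y Ty; rewrite !ler_norml ![dot (u - v) _]dotC !dotE.
  rewrite ![dot _ u]dotC ![dot _ v]dotC /A => /andP[? ?] /andP[? ?]; lra.
move=> u.
have dist_cvg := @cvgrPdist_lt R R _ (nbhs u) (nbhs_filter u) (dwidth T) (dwidth T u).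
apply/dist_cvg => e e0.
have : \forall v \near u, `|u - v| < e / A.
  have := nbhsx_ballx u (e / A) (divr_gt0 e0 A0).
  by rewrite -ball_normE.
apply: (@filterS _ (nbhs u)) => v; rewrite ltr_pdivlMr// mulrC => uv.
rewrite ltr_norml; have := lip u v; have := lip v u; rewrite distrC.
by move=> ? ?; apply/andP; split; lra.
Qed.

(** The ratio is invariant under positive scaling of the direction, so a minimum of the continuous
    ratio on the compact unit sphere of the max norm is a global one. *)
Lemma exists_min_ratio T : compact T -> T !=set0 -> exists2 u, u != 0 &
  forall v, v != 0 -> dwidth T u / dwidth C u <= dwidth T v / dwidth C v.
Proof.
move=> cT T0; pose S := [set u : 'rV[R]_d | `|u| = 1].
have S_neq0 u : S u -> u != 0.
  by move=> Su; apply: contraPneq Su => ->; rewrite /S/= normr0 => /esym/eqP; rewrite oner_eq0.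
have normalize u : u != 0 -> S (`|u|^-1 *: u).
  by move=> u0; rewrite /S/= normrZ normfV normr_id mulVf// normr_eq0.
have S0 : S !=set0.
  by have [u /normalize Su] := @exists_normal R d d_gt0; exists (`|u|^-1 *: u).
have cS : compact S.
  apply: bounded_closed_compact.
    by exists 1; split => // M M1 u /= ->; exact: ltW.
  have -> : S = Num.norm @^-1` [set 1] by [].
  apply: preimage_closed => [u _|]; first exact: norm_continuous.
  exact: closed_eq.
have [|u /set_mem Su umin] := compact_EVT_min (f := fun u => dwidth T u / dwidth C u) S0 cS.
  apply: continuous_in_subspaceT => u /set_mem /S_neq0 u0.
  have := @cvgM R _ (nbhs u) (nbhs_filter u) (dwidth T) (fun u => (dwidth C u)^-1).
  apply; first exact: continuous_dwidth.
  have := @cvgV R _ (nbhs u) (nbhs_filter u) (dwidth C).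
  by apply; [rewrite gt_eqF// dwidth_gt0|exact: continuous_dwidth].
exists u => [|v v0]; first exact: S_neq0.
have := umin _ (mem_set (normalize v v0)).
rewrite !dwidthZ ?invr_ge0//.
have v1 : `|v|^-1 != 0 by rewrite invr_eq0 normr_eq0.
by rewrite invfM mulrACA divff// mul1r.
Qed.

End MinimalWidth.

(** * Lower bound for successive cuts, and equally spaced slices *)

Section Cuts.
Context {R : realType} {d : nat}.
Implicit Types (x y z u v : 'rV[R]_d) (C K L P : set 'rV[R]_d).

Lemma successive_cuts_size K k Ks : successive_cuts K k Ks -> size Ks = k.+1.
Proof.
by elim=> // {}k Ks1 P Ks2 u a _; rewrite !size_cat /= !addnS => ->.
Qed.

Lemma successive_cuts_convex_body K k Ks : convex_body K -> successive_cuts K k Ks ->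
  forall P, P \in Ks -> convex_body P.
Proof.
move=> hK; elim=> [P|{}k Ks1 P Ks2 u a _ IH _ int1 int2 Q].
  by rewrite inE => /eqP ->.
have [cP convP _] : convex_body P by apply: IH; rewrite mem_cat inE eqxx orbT.
rewrite mem_cat !inE => /or4P[QK|/eqP ->|/eqP ->|QK].
- by apply: IH; rewrite mem_cat QK.
- split => //.
    by apply: compact_closedI => //; exact: closed_halfspace_le.
  by apply: convex_setI => //; exact: convex_halfspace_le.
- split => //.
    by apply: compact_closedI => //; exact: closed_halfspace_ge.
  by apply: convex_setI => //; exact: convex_halfspace_ge.
- by apply: IH; rewrite mem_cat inE QK !orbT.
Qed.

(** By [core_width_cut] each cut lowers the sum by at most [r], as only one piece changes. *)
Lemma core_width_successive_cuts C K k Ks (r : R) : (0 < d)%N -> convex_body C ->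
    convex_body K -> 0 <= r -> successive_cuts K k Ks ->
  core_width C K r <= \sum_(P <- Ks) core_width C P r + k%:R * r.
Proof.
move=> d0 hC hK r0; elim=> [|{}k Ks1 P Ks2 u a cuts IH u0 int1 int2].
  by rewrite big_seq1 mul0r addr0.
have [cP convP _] : convex_body P.
  by apply: (successive_cuts_convex_body _ _ _ hK cuts); rewrite mem_cat inE eqxx orbT.
have := core_width_cut C hC d0 P r u a cP convP u0 r0.
move: IH; rewrite !big_cat/= !big_cons -natr1 mulrDl mul1r; lra.
Qed.

(** Otherwise take [r] strictly between the maximum and [rho]. The cores of the pieces at [r] have
    total width at most n(m-1)r, so the core of [K] has width at most n(m-1)r + (n-1)r = (mn-1)r,
    which is too small. *)
Lemma max_succ_inradius_ge C K (m n : nat) Ks : (0 < d)%N -> convex_body C ->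
    convex_body K -> (0 < m)%N -> (0 < n)%N -> successive_cuts K n.-1 Ks ->
  succ_inradius C K (m * n) <= max_succ_inradius C m Ks.
Proof.
move=> d0 hC hK m0 n0 cuts; set rho := succ_inradius _ _ _; set M := max_succ_inradius _ _ _.
have mn0 : (0 < m * n)%N by rewrite muln_gt0 m0.
have [rho0 wK _] := succ_inradius_core_radius C hC d0 K _ hK mn0.
rewrite -/rho in rho0 wK.
have M0 : 0 <= M by exact: bigmax_ge_id.
have m1 : 0 <= m%:R - 1 :> R by rewrite subr_ge0 ler1n.
rewrite leNgt; apply/negP => Mrho.
pose r := (M + rho) / 2.
have Mr : M < r by rewrite /r; lra.
have rrho : r < rho by rewrite /r; lra.
have r0 : 0 < r by exact: le_lt_trans Mr.
have piece P : P \in Ks -> core_width C P r <= (m%:R - 1) * r.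
  move=> PKs; have hP := successive_cuts_convex_body _ _ _ hK cuts P PKs.
  rewrite leNgt; apply/negP => /core_width_adherent[|l' ll' wl'].
    by rewrite mulr_ge0// ltW.
  have := wide_core_radius C hC P _ _ _ _ m1 (succ_inradius_core_radius C hC d0 P m hP m0)
    wl' (ltW ll').
  rewrite leNgt => /negP; apply; apply: le_lt_trans Mr.
  exact: (@le_bigmax_seq _ _ _ Ks 0 P xpredT (fun P => succ_inradius C P m)).
have [cK _ _] := hK.
(* The width at [r] is at least (mn-1)rho + (rho-r) = mn rho - r, and this exceeds (mn-1)r. *)
have wr := wide_core_shrink C hC K _ r rho (ltW r0) (ltW rrho) wK.
have mnE : (m * n)%:R = m%:R * n%:R :> R by rewrite natrM.
have : (m * n)%:R * rho - r <= core_width C K r.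
  apply: ub_le_sup; first exact: core_width_ub.
  rewrite (_ : _ - r = ((m * n)%:R - 1) * rho + (rho - r)); last by ring.
  split=> // {wr}; rewrite addr_ge0// ?mulr_ge0 ?subr_ge0 ?(ltW rho0) ?(ltW rrho)//.
  by rewrite ler1n.
move=> /le_trans/(_ (core_width_successive_cuts C K _ Ks r d0 hC hK (ltW r0) cuts)).
have : \sum_(P <- Ks) core_width C P r <= n%:R * ((m%:R - 1) * r).
  rewrite big_seq (@le_trans _ _ (\sum_(P <- Ks | P \in Ks) (m%:R - 1) * r))//.
    exact: ler_sum.
  rewrite -big_seq.
  rewrite big_const_seq count_predT iter_addr_0 (successive_cuts_size _ _ _ cuts) prednK//.
  by rewrite mulr_natl.
have -> : n.-1%:R = n%:R - 1 :> R by rewrite -subn1 natrB.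
have mn1 : 0 < (m * n)%:R :> R by rewrite ltr0n.
have : (m * n)%:R * r < (m * n)%:R * rho by rewrite ltr_pM2l.
rewrite mnE; lra.
Qed.

(** A point [y] of [K] strictly between the two levels is moved towards an interior point [z], so
    little that it stays strictly between them. *)
Lemma slab_interior K u (a b : R) p q : convex_set K -> K° !=set0 -> a < b ->
    K p -> K q -> dot u p < b -> a < dot u q ->
  (K `&` halfspace_ge u a `&` halfspace_le u b)° !=set0.
Proof.
move=> convK [z Kz] ab Kp Kq pb aq.
have [y Ky /andP[ay yb]] : exists2 y, K y & a < dot u y < b.
  have [ap|pa] := ltP a (dot u p); first by exists p; rewrite ?ap.
  have [qb|bq] := ltP (dot u q) b; first by exists q; rewrite ?qb ?aq.
  have D0 : 0 < dot u q - dot u p by lra.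
  (* Now [p] and [q] lie on different sides of the slab, and their segment meets the middle level at
     this parameter. *)
  pose t := ((a + b) / 2 - dot u p) / (dot u q - dot u p).
  exists (t *: q + (1 - t) *: p).
    move/convex_setP: convK; apply => //; first by rewrite divr_ge0//; lra.
    by rewrite ler_pdivrMr// mul1r; lra.
  have -> : dot u (t *: q + (1 - t) *: p) = (a + b) / 2.
    by rewrite !dotE /t; field; rewrite gt_eqF.
  by apply/andP; split; lra.
pose e := Num.min (b - dot u y) (dot u y - a).
have e0 : 0 < e by rewrite lt_min !subr_gt0 yb.
have eb : e <= b - dot u y by rewrite ge_min lexx.
have ea : e <= dot u y - a by rewrite ge_min lexx orbT.
(* [t] is chosen so that the height changes by at most [e / 2], where [e] is the distance from the
   height of [y] to the nearer level. *)
pose g := dot u z - dot u y; pose t := e / (2 * (e + `|g|)).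
have eg0 : 0 < e + `|g| by rewrite ltr_wpDr.
have t0 : 0 < t by rewrite divr_gt0// mulr_gt0.
have te : t * (e + `|g|) = e / 2 by rewrite /t; field; rewrite gt_eqF.
have t1 : t <= 1 by rewrite ler_pdivrMr ?mulr_gt0// mul1r; have := normr_ge0 g; lra.
have tg : `|t * g| < e.
  by rewrite normrM gtr0_norm//; have := mulr_gt0 t0 e0; lra.
pose x := t *: z + (1 - t) *: y.
have Kx : K° x by exact: convex_interior.
have xE : dot u x = dot u y + t * g by rewrite !dotE /g; ring.
move: tg; rewrite ltr_norml => /andP[tg1 tg2].
exists x; apply: (@filterI _ (nbhs x)); first apply: (@filterI _ (nbhs x)) => //.
  have : nbhs x [set w | a < dot u w].
    by apply: (@cvgr_gt _ _ (nbhs x) _ _ _ (continuous_dot u x)); rewrite xE; lra.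
  by apply: (@filterS _ (nbhs x)) => w /ltW.
have : nbhs x [set w | dot u w < b].
  by apply: (@cvgr_lt _ _ (nbhs x) _ _ _ (continuous_dot u x)); rewrite xE; lra.
by apply: (@filterS _ (nbhs x)) => w /ltW.
Qed.

(** The cuts are made in increasing order of level, each dividing the last piece of the list. Only
    the levels [lv 1] to [lv n] are cuts; [lv 0] and [lv n.+1] serve to express that all slabs have
    interior points. *)
Lemma successive_cuts_slabs K u (lv : nat -> R) n : u != 0 ->
    (forall k, (k <= n)%N -> lv k <= lv k.+1) ->
    (forall k, (k <= n)%N ->
      (K `&` halfspace_ge u (lv k) `&` halfspace_le u (lv k.+1))° !=set0) ->
  successive_cuts K n (mkseq (fun k => K `&`
    [set x | ((0 < k)%N -> halfspace_ge u (lv k) x) /\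
             ((k.+1 < n.+1)%N -> halfspace_le u (lv k.+1) x)]) n.+1).
Proof.
move=> u0; elim: n => [|n IHn] lv_mono lv_int.
  rewrite /mkseq/= (_ : K `&` _ = K); first exact: successive_cuts0.
  by apply/seteqP; split => [x []|x Kx]//; split.
have {IHn} := IHn (fun k kn => lv_mono k (leqW kn)) (fun k kn => lv_int k (leqW kn)).
pose slab N k := K `&` [set x | ((0 < k)%N -> halfspace_ge u (lv k) x) /\
  ((k.+1 < N)%N -> halfspace_le u (lv k.+1) x)].
rewrite -/(slab n.+1) -/(slab n.+2) !mkseqS -!cats1 => cuts.
have lvn := lv_mono n (leqnSn n).
have slabs_n : mkseq (slab n.+2) n = mkseq (slab n.+1) n.
  apply/eq_in_map => k; rewrite mem_iota/= add0n => kn.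
  by rewrite /slab !ltnS kn (ltnW kn).
have le_n : slab n.+1 n `&` halfspace_le u (lv n.+1) = slab n.+2 n.
  by apply/seteqP; split => [x [[Kx [xn _]] xl]|x [Kx [xn xl]]]; do ?split => //;
    [rewrite ltnn|apply: xl].
(* The former lower bound [lv n] follows from the new one, as the levels increase. *)
have ge_n : slab n.+1 n `&` halfspace_ge u (lv n.+1) = slab n.+2 n.+1.
  apply/seteqP; split => [x [[Kx [_ _]] xl]|x [Kx [/(_ isT) xn _]]].
    by split => //; split => //; rewrite ltnn.
  split=> //; split => //; split; last by rewrite ltnn.
  by move=> _; exact: le_trans xn.
rewrite slabs_n -catA -le_n -ge_n; apply: successive_cutsS => //.
  have [x Kx] := lv_int n (leqnSn n); exists x; move: Kx; apply: interiorS.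
  by rewrite le_n => w [[Kw wn] wn1].
have [x Kx] := lv_int n.+1 (leqnn _); exists x; move: Kx; apply: interiorS.
by rewrite ge_n => w [[Kw wn] wn1]; split => //; split => //; rewrite ltnn.
Qed.

(** [p] and [q] witness a positive width of [L], so the levels increase strictly. Extreme points of
    [L], which belong to [K], lie on the two outermost levels, as needed for [slab_interior]. *)
Lemma equal_slices_cuts C K L u n p q : L `<=` K -> compact L -> convex_body K -> u != 0 ->
    (0 < n)%N -> L p -> L q -> dot u p < dot u q ->
  successive_cuts K n.-1 (equal_slices K L u n).
Proof.
move=> LK cL [cK convK K0] u0; case: n => // n _ Lp Lq pq.
have L0 : L !=set0 by exists p.
have [p' Lp' [pE pmin]] := compact_supp_min L u cL L0.
have [q' Lq' [qE qmax]] := compact_supp_max L u cL L0.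
have D0 : 0 < supp_max L u - supp_min L u.
  by rewrite pE qE subr_gt0 (le_lt_trans (pmin p Lp))// (lt_le_trans pq)// qmax.
have n0 : 0 < n.+1%:R :> R by [].
have lv_lt i j : (i < j)%N -> cut_level L u n.+1 i < cut_level L u n.+1 j.
  by move=> ij; rewrite ltrD2l ltr_pM2r// ltr_pM2r ?invr_gt0// ltr_nat.
have lv0 : cut_level L u n.+1 0 = dot u p' by rewrite /cut_level !mul0r addr0.
have lvn : cut_level L u n.+1 n.+1 = dot u q'.
  by rewrite /cut_level divff ?gt_eqF// mul1r subrKC.
apply: successive_cuts_slabs => // k kn; first exact/ltW/lv_lt.
apply: (slab_interior K u _ _ p' q' convK K0) => //; try exact: LK.
- exact: lv_lt.
- by rewrite -lv0 lv_lt.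
- by rewrite -lvn lv_lt.
Qed.

(** If the inradius [r] of the slice exceeded [rho], its core at [rho] would be wide enough to give
    two points of [P] and [L] whose heights differ by at least [m%:R * r * dwidth C u], more than
    the slab allows. *)
Lemma succ_inradius_equal_slice C K u (m n k : nat) : (0 < d)%N -> convex_body C ->
    convex_body K -> (0 < m)%N -> (0 < n)%N -> (k < n)%N -> u != 0 ->
  let rho := succ_inradius C K (m * n) in
  let L := rounded_body C K rho in
  let P := K `&` [set x | ((0 < k)%N -> halfspace_ge u (cut_level L u n k) x) /\
    ((k.+1 < n)%N -> halfspace_le u (cut_level L u n k.+1) x)] in
  dwidth L u = (m * n)%:R * rho * dwidth C u -> convex_body P ->
  succ_inradius C P m <= rho.
Proof.
move=> d0 hC hK m0 n0 kn u0 rho L P wL hP.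
have mn0 : (0 < m * n)%N by rewrite muln_gt0 m0.
have [rho0 wK _] := succ_inradius_core_radius C hC d0 K _ hK mn0.
have [r0 wP _] := succ_inradius_core_radius C hC d0 P _ hP m0.
set r := succ_inradius C P m in r0 wP *; rewrite -/rho in rho0 wK.
rewrite leNgt; apply/negP => rhor.
have [cC _ [z0 /interior_subset Cz0]] := hC; have C0 : C !=set0 by exists z0.
have [cK _ _] := hK.
have cL : compact L by exact: compact_rounded_body.
have L0 : L !=set0.
  by apply: rounded_body_neq0 => //; have [x [_ [Kx _ _]]] := wK 0; exists x.
have [p Lp [pE pmin]] := compact_supp_min L u cL L0.
have [q Lq [qE qmax]] := compact_supp_max L u cL L0.
have w0 := dwidth_gt0 C u hC u0.
have [x [y [Px Py xy]]] := wide_core_shrink C hC P _ _ _ (ltW rho0) (ltW rhor) wP u.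
have [c [c' [Cc Cc' cE]]] := dwidth_attained C u cC C0.
(* A translate of [rho] times [C] inside [P] is also inside [K], hence part of the rounded body
   [L]. *)
have PL z e : core C P rho z -> C e -> P (z + rho *: e) /\ L (z + rho *: e).
  move=> /coreP Pz Ce; split; first exact: Pz.
  by apply: core_rounded_body => //; apply/coreP => e' /Pz[].
have n_gt0 : 0 < n%:R :> R by rewrite ltr0n.
have [[_ [_ xu]] Lx] := PL x c Px Cc; have [[_ [yl _]] Ly] := PL y c' Py Cc'.
(* The last slice has no upper cut and the first one no lower cut; there the bounds come from
   membership in [L]. *)
have x_le : dot u (x + rho *: c) <= cut_level L u n k.+1.
  have [kn1|nk] := ltnP k.+1 n; first exact: xu.
  have <- : n = k.+1 by apply/eqP; rewrite eqn_leq nk kn.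
  by rewrite /cut_level divff ?gt_eqF// mul1r subrKC qE qmax.
have y_ge : cut_level L u n k <= dot u (y + rho *: c').
  have [k0|k0] := posnP k; last exact: yl.
  by rewrite k0 /cut_level !mul0r addr0 pE pmin.
have : cut_level L u n k.+1 - cut_level L u n k = m%:R * rho * dwidth C u.
  rewrite /cut_level -/(dwidth L u) wL natrM -natr1; field; rewrite gt_eqF//.
have : rho * dwidth C u < r * dwidth C u by rewrite ltr_pM2r.
have m_gt0 : 0 < m%:R :> R by rewrite ltr0n.
rewrite -(ltr_pM2l m_gt0).
move: xy x_le y_ge; rewrite cE !dotE; lra.
Qed.

End Cuts.

(** * The minimum and the optimal slicing *)

Theorem theorem2p1 (R : realType) (d : nat) (hd : (2 <= d)%N)
    (K C : set 'rV[R]_d) (hK : convex_body K) (hC : convex_body C)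
    (m n : nat) (hm : (0 < m)%N) (hn : (0 < n)%N) :
  let rho := succ_inradius C K (m * n) in
  let L := rounded_body C K rho in
  [/\ (exists Ks, successive_cuts K n.-1 Ks /\ max_succ_inradius C m Ks = rho),
      (forall Ks, successive_cuts K n.-1 Ks -> rho <= max_succ_inradius C m Ks),
      (exists u : 'rV[R]_d, u != 0 /\ rel_width C L u = min_rel_width C L) &
      (forall u : 'rV[R]_d, u != 0 -> rel_width C L u = min_rel_width C L ->
         successive_cuts K n.-1 (equal_slices K L u n) /\
         max_succ_inradius C m (equal_slices K L u n) = rho)].
Proof.
move=> rho L; have d0 : (0 < d)%N by exact: ltnW.
have mn0 : (0 < m * n)%N by rewrite muln_gt0 hm.
have radius := succ_inradius_core_radius C hC d0 K _ hK mn0; rewrite -/rho in radius.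
have [_ minE] := (min_rel_width_core_radius C hC d0 K rho _ hK mn0).2 radius.
rewrite -/L in minE; have [rho0 wK _] := radius.
have [cK _ _] := hK; have [cC _ [z /interior_subset Cz]] := hC.
have C0 : C !=set0 by exists z.
have K0 : core C K rho !=set0 by have [x [_ [Kx _ _]]] := wK 0; exists x.
have cT := compact_core C hC K rho cK.
have cL : compact L by exact: compact_rounded_body.
have L0 : L !=set0 by exact: rounded_body_neq0.
have lower Ks : successive_cuts K n.-1 Ks -> rho <= max_succ_inradius C m Ks.
  exact: max_succ_inradius_ge.
have slices u : u != 0 -> rel_width C L u = min_rel_width C L ->
    successive_cuts K n.-1 (equal_slices K L u n) /\
    max_succ_inradius C m (equal_slices K L u n) = rho.
  move=> u0; rewrite minE rel_widthE// => wL.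
  have w0 := dwidth_gt0 C u hC u0.
  have {}wL : dwidth L u = (m * n)%:R * rho * dwidth C u by rewrite -wL divfK// gt_eqF.
  have [q [p [Lq Lp pqE]]] := dwidth_attained L u cL L0.
  have cuts : successive_cuts K n.-1 (equal_slices K L u n).
    apply: (equal_slices_cuts _ _ _ _ _ p q) => //; first exact: rounded_body_sub.
    by rewrite -subr_gt0 -pqE wL !mulr_gt0// ltr0n.
  split=> //; apply/eqP; rewrite eq_le lower// andbT.
  (* Besides the bound on each slice, [0 <= rho] is required, for the default value of the
     maximum. *)
  rewrite /max_succ_inradius big_seq; apply: bigmax_le => [|P PKs]; first exact: ltW.
  have hP := successive_cuts_convex_body K _ _ hK cuts P PKs.
  have [k /[!mem_iota]/= kn PE] := mapP PKs; rewrite PE in hP *.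
  exact: succ_inradius_equal_slice.
have [u [u0 uE]] : exists u : 'rV[R]_d, u != 0 /\ rel_width C L u = min_rel_width C L.
  (* A minimal direction for the core is minimal for [L], since their relative widths differ by the
     constant [rho]. *)
  have [u u0 umin] := exists_min_ratio C hC d0 (core C K rho) cT K0.
  exists u; split => //; apply/eqP; rewrite eq_le; apply/andP; split.
    apply: lb_le_inf; first by exists (rel_width C L u), u.
    move=> _ [v v0 <-].
    by rewrite !rel_width_rounded_body// ?lerD2r ?umin// ltW.
  apply: ge_inf; last by exists u.
  exists 0 => _ [v v0 <-].
  by rewrite rel_widthE// divr_ge0 ?dwidth_ge0.
split=> //; last by exists u.
by exists (equal_slices K L u n); exact: slices.
Qed.
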